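(* Let $\pi\in\mathcal{C}_3$ be an $n$-qubit permutation gate. Then there exist $n$-qubit Clifford permutations $\phi_1,\phi_2$ and an $n$-qubit permutation gate $\mu$ that is a product of Toffoli gates in staircase form such that $\mu\in\mathcal{C}_3$ and $\pi=\phi_1\mu\phi_2$.
   Context: Gates are unitary operators on $(\mathbb{C}^2)^{\otimes n}$, with computational basis $\{|v\rangle : v\in\mathbb{F}_2^n\}$. The Pauli group $\mathcal{P}_n$ consists of all $cP_1\otimes\cdots\otimes P_n$ with $c\in\{\pm1,\pm i\}$ and $P_j\in\{I_2,X,Y,Z\}$. The Clifford hierarchy: $\mathcal{C}_1=\mathcal{P}_n$, and for $k\ge2$, $\mathcal{C}_k$ is the set of unitaries $U$ with $UPU^\dagger\in\mathcal{C}_{k-1}$ for all $P\in\mathcal{P}_n$. $\mathcal{C}_2$ is the Clifford group. A permutation gate is a unitary whose matrix in the computational basis is a $2^n\times2^n$ permutation matrix. A Clifford permutation is a permutation gate in $\mathcal{C}_2$. For distinct $i,j,k\in[n]$, the Toffoli gate $\mathrm{Tof}_{i,j,k}$ is the permutation gate $|a_1,\dots,a_n\rangle\mapsto|a'_1,\dots,a'_n\rangle$ with $a'_k=a_k+a_ia_j$ and $a'_l=a_l$ for $l\ne k$; $k$ is its target and $i,j$ are its controls. A (possibly empty) product of pairwise distinct Toffoli gates is in staircase form if each gate $\mathrm{Tof}_{i,j,k}$ in the product has $i<j<k$ and the target qubits are nondecreasing in the order in which the gates are applied. *)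

(* Defs.v *)
From mathcomp Require Import all_boot all_order all_algebra.
From mathcomp Require Export reals complex.

Set Implicit Arguments.
Unset Strict Implicit.
Unset Printing Implicit Defensive.

Import GRing.Theory Num.Theory.
Local Open Scope ring_scope.
Local Open Scope sesquilinear_scope.

(* Computational basis labels. An operator on (C^2)^{(x) n} is given by its
   matrix in the computational basis; rows and columns are numbered by an
   enumeration of 'F_2^n, so row/column a stands for the ket |enum_val a>. *)
Notation bits n := 'rV['F_2]_n.
Notation qdim n := #|{: bits n}|.
Notation operator C n := 'M[C]_(qdim n).

Lemma qdimE n : qdim n = (2 ^ n)%N.
Proof. by rewrite card_mx card_ord mul1n. Qed.

Definition basis_label n (a : 'I_(qdim n)) : bits n := enum_val a.

(* The operator |v> |-> |f v>. *)
Definition basis_map_op (C : numClosedFieldType) n (f : bits n -> bits n) :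
    operator C n :=
  \matrix_(a, b) (basis_label a == f (basis_label b))%:R.

(* The one-qubit matrices are indexed by 'I_2, which is convertible to 'F_2. *)
Definition pauliX (C : numClosedFieldType) : 'M[C]_2 :=
  \matrix_(a, b) (a != b)%:R.

Definition pauliY (C : numClosedFieldType) : 'M[C]_2 :=
  \matrix_(a, b) if a == b then 0 else if a == 0 then - 'i else 'i.

Definition pauliZ (C : numClosedFieldType) : 'M[C]_2 :=
  \matrix_(a, b) if a == b then (-1) ^+ a else 0.

(* P_1 (x) ... (x) P_n: its (v, w) entry is the product of the (v_j, w_j)
   entries of the P_j. *)
Definition tensor_op (C : numClosedFieldType) n (P : 'I_n -> 'M[C]_2) :
    operator C n :=
  \matrix_(a, b) \prod_(j < n) P j (basis_label a 0 j) (basis_label b 0 j).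

Definition pauli_group (C : numClosedFieldType) n (U : operator C n) : Prop :=
  exists (c : C) (P : 'I_n -> 'M[C]_2),
    [/\ c \in [:: 1; -1; 'i; - 'i],
        forall j, P j \in [:: 1%:M; pauliX C; pauliY C; pauliZ C]
      & U = c *: tensor_op P].

(* The hierarchy starts at level 1; level 0 is empty by convention. *)
Fixpoint clifford_hierarchy (C : numClosedFieldType) n (k : nat)
    (U : operator C n) : Prop :=
  match k with
  | 0 => False
  | k'.+1 =>
    match k' with
    | 0 => pauli_group U
    | _.+1 => U \is unitarymx /\
        forall P : operator C n, pauli_group P ->
          clifford_hierarchy k' (U *m P *m U^t*)
    end
  end.

Definition permutation_gate (C : numClosedFieldType) n (U : operator C n) :
    Prop :=
  U \is unitarymx /\ is_perm_mx U.

Definition clifford_permutation (C : numClosedFieldType) n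
    (U : operator C n) : Prop :=
  permutation_gate U /\ clifford_hierarchy 2 U.

(* A triple (i, j, k) stands for Tof_{i,j,k}: controls i and j, target k. *)
Definition toffoli_fun n (t : 'I_n * 'I_n * 'I_n) (v : bits n) : bits n :=
  let: (i, j, k) := t in
  \row_l if l == k then v 0 k + v 0 i * v 0 j else v 0 l.

Definition toffoli (C : numClosedFieldType) n (t : 'I_n * 'I_n * 'I_n) :
    operator C n :=
  basis_map_op C (toffoli_fun t).

(* The head of s is the gate applied first, hence the rightmost factor. *)
Definition toffoli_circuit (C : numClosedFieldType) n
    (s : seq ('I_n * 'I_n * 'I_n)) : operator C n :=
  foldl (fun U t => toffoli C t *m U) 1%:M s.

Definition staircase (C : numClosedFieldType) n
    (s : seq ('I_n * 'I_n * 'I_n)) : bool :=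
  [&& uniq [seq toffoli C t | t <- s],
      all (fun t : 'I_n * 'I_n * 'I_n => let: (i, j, k) := t in
             (i < j < k)%N) s
    & sorted leq [seq nat_of_ord t.2 | t <- s]].

(* Main.v *)
Require Import Defs.
From mathcomp Require Import all_boot all_order fingroup perm all_algebra.

Set Implicit Arguments.
Unset Strict Implicit.
Unset Printing Implicit Defensive.

Import GRing.Theory Num.Theory.
Local Open Scope ring_scope.
Local Open Scope sesquilinear_scope.

(** Let [pi |v> = |f v>] and let [g] be the inverse of [f]. Conjugating the
    Paulis X and Z by [pi] shows that all maps [v |-> f (g v + a)] are affine and
    that [g] has affine derivatives, that is, degree at most 2. These affine maps
    form a regular elementary abelian 2-group, so their linear parts have a
    common nonzero fixed vector [w]. Translation by [w] commutes with the regular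
    abelian group, hence belongs to it: [g (x + w) = g x + b] for some [b]. After
    linear changes of coordinates [w] and [b] are the last unit vector, so [g]
    descends to the first [n - 1] coordinates and its last coordinate is
    [x_n + q (x_1, .., x_(n-1))] with [q] of degree at most 2; the affine part of
    [q] is removed by a shear of the source. By induction [g] becomes
    [x_k |-> x_k + Q_k (x_1, .., x_(k-1))] with [Q_k] a sum of products
    [x_i * x_j], [i < j]. The inverse of such a map is computed in place, one
    coordinate after the other, by Toffoli gates in staircase form. *)

(** * Arithmetic over the field with two elements *)

Lemma F2P (x : 'F_2) : x = 0 \/ x = 1.
Proof. by case: x => -[|[|//]] i; [left|right]; apply/val_inj. Qed.

Lemma addFF (x : 'F_2) : x + x = 0.
Proof. by case: (F2P x) => ->; apply/val_inj. Qed.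

Section Char2.
Variable n : nat.
Implicit Types x y : bits n.

Lemma bitsDD x : x + x = 0.
Proof. by apply/rowP=> j; rewrite !mxE addFF. Qed.

Lemma bitsDK y x : x + y + y = x.
Proof. by rewrite -addrA bitsDD addr0. Qed.

Lemma bitsKD y x : y + (y + x) = x.
Proof. by rewrite addrA bitsDD add0r. Qed.

End Char2.

(** * Affine and quadratic maps *)

(** Affine combinations over ['F_2] are sums of oddly many points, so triple sums suffice and no
    linear part has to be named. *)
Definition affine (U V : zmodType) (g : U -> V) :=
  forall x y z, g (x + y + z) = g x + g y + g z.

Definition quadratic (U V : zmodType) (g : U -> V) :=
  forall a, affine (fun v => g v + g (v + a)).

Section Affine.
Variables U V W : zmodType.

Lemma affine_comp (g : V -> W) (h : U -> V) :
  affine g -> affine h -> affine (g \o h).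
Proof. by move=> Ag Ah x y z; rewrite /= Ah Ag. Qed.

Lemma affine_eq (g h : U -> V) : g =1 h -> affine g -> affine h.
Proof. by move=> E A x y z; rewrite -!E A. Qed.

Lemma additive_affine (g : U -> V) : {morph g : x y / x + y} -> affine g.
Proof. by move=> A x y z; rewrite !A. Qed.

End Affine.

Lemma affine_sub0 m n (g : bits m -> bits n) : affine g ->
  {morph (fun x => g x + g 0) : x y / x + y}.
Proof.
move=> A x y /=.
by rewrite -[x + y]addr0 A -!addrA (addrCA (g 0)).
Qed.

Lemma affine_shift m n (g : bits m -> bits n) x a :
  affine g -> g (x + a) = g x + (g a + g 0).
Proof. by move=> A; rewrite -[x + a]addr0 A addrA. Qed.

Lemma affine_inv m n (g : bits m -> bits n) (h : bits n -> bits m) :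
  cancel g h -> cancel h g -> affine g -> affine h.
Proof.
by move=> gK hK A x y z; rewrite -{1}[x]hK -{1}[y]hK -{1}[z]hK -A gK.
Qed.

(** The derivative along [a] becomes a derivative of [q] along [b a + b 0], the linear part of [b]
    applied to [a]. *)
Lemma quadratic_precomp l m (V : zmodType) (q : bits m -> V)
    (b : bits l -> bits m) :
  affine b -> quadratic q -> quadratic (q \o b).
Proof.
move=> Ab Q a; pose a' := b a + b 0.
apply: (affine_eq (g := (fun v => q v + q (v + a')) \o b));
  last exact: affine_comp.
by move=> v /=; rewrite (affine_shift _ _ Ab).
Qed.

Lemma quadratic_postcomp (U V W : zmodType) (q : U -> V) (b : V -> W) :
  {morph b : x y / x + y} -> quadratic q -> quadratic (b \o q).
Proof.
move=> Mb Q a; apply: (affine_eq (g := b \o (fun v => q v + q (v + a)))).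
  by move=> v /=; rewrite Mb.
by apply: affine_comp (Q a); apply: additive_affine.
Qed.

(** * Polarization of quadratic functions *)

Notation unitb j := (delta_mx 0 j : bits _).

Lemma additive_expand n (h : bits n -> 'F_2) : {morph h : x y / x + y} ->
  forall x, h x = \sum_j x 0 j * h (unitb j).
Proof.
move=> Mh x; have h0 : h 0 = 0 by rewrite -[0]addr0 Mh addFF.
rewrite {1}[x]row_sum_delta (big_morph h Mh h0); apply: eq_bigr => j _.
by case: (F2P (x 0 j)) => ->; rewrite ?scale0r ?h0 ?mul0r // scale1r mul1r.
Qed.

Definition quad_form n (c : 'I_n -> 'I_n -> 'F_2) (x : bits n) : 'F_2 :=
  \sum_(i < n) \sum_(j < n | (i < j)%N) c i j * (x 0 i * x 0 j).

(** The polar form [B] of [q] is bilinear and alternating. The quadratic form with coefficients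
    [B (unitb i) (unitb j)], [i < j], has the same polar form, so its sum with [q] has polar form
    zero, which makes it affine. *)
Lemma quadratic_expand n (q : bits n -> 'F_2) : quadratic q ->
  exists c, affine (fun x => q x + quad_form c x).
Proof.
move=> Q; pose B x y := q (x + y) + q x + q y + q 0.
have F4 (a b c d : 'F_2) : a + b + c + d = 0 -> a = b + c + d.
  by case: (F2P a) (F2P b) (F2P c) (F2P d) => -> [] -> [] -> [] -> // _;
    apply/val_inj.
have BC x y : B x y = B y x by rewrite /B (addrC x y) -!addrA (addrCA (q x)).
(* This is [Q] for the direction [y], at the points [x], [z] and 0. *)
have Bl y : {morph B^~ y : x z / x + z}.
  move=> x z; have := Q y x z 0; rewrite addr0 add0r /B.
  move: (q _) (q _) (q _) (q _) (q _) (q _) (q _) (q _) => a b c d e f g h.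
  by case: (F2P a) (F2P b) (F2P c) (F2P d) (F2P e) (F2P f) (F2P g) (F2P h)
    => -> [] -> [] -> [] -> [] -> [] -> [] -> [] -> // _; apply/val_inj.
have Br x : {morph B x : y z / y + z} by move=> y z; rewrite !(BC x) Bl.
have B0 x : B x x = 0.
  rewrite /B bitsDD.
  by move: (q 0) (q x) => a b; case: (F2P a) (F2P b) => -> [] ->; apply/val_inj.
pose c i j := B (unitb i) (unitb j).
have BE x y : B x y = \sum_i \sum_j x 0 i * (y 0 j * c i j).
  rewrite (additive_expand (Bl y)); apply: eq_bigr => i _.
  by rewrite (additive_expand (Br _)) mulr_sumr.
(* The diagonal terms vanish, and by symmetry the terms at (i, j) and (j, i) share one
   coefficient. *)
have BS x y : B x y = \sum_(i < n) \sum_(j < n | (i < j)%N)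
    c i j * (x 0 i * y 0 j + x 0 j * y 0 i).
  rewrite BE; transitivity (\sum_(i < n)
      (\sum_(j < n | (i < j)%N) x 0 i * (y 0 j * c i j)
       + \sum_(j < n | (j < i)%N) x 0 i * (y 0 j * c i j))).
    apply: eq_bigr => i _; rewrite (bigID (fun j : 'I_n => (i < j)%N)) /=;
      congr (_ + _).
    rewrite (bigD1 i) ?ltnn //= {1}/c B0 !mulr0 add0r.
    apply: eq_bigl => j; rewrite -leqNgt ltn_neqAle andbC; congr (_ && _).
  rewrite big_split /= [X in _ + X](exchange_big_dep predT) //= -big_split /=.
  apply: eq_bigr => i _; rewrite -big_split /=; apply: eq_bigr => j _.
  by rewrite [c j i]BC -/(c i j) !mulrA -mulrDl mulrC.
exists c.
pose r x := q x + quad_form c x.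
have rD x y : r (x + y) = r x + r y + r 0.
  have E : quad_form c (x + y) + quad_form c x + quad_form c y + quad_form c 0
    = B x y.
    rewrite BS /quad_form -!big_split /=; apply: eq_bigr => i _.
    rewrite -!big_split /=; apply: eq_bigr => j _; rewrite !mxE -!mulrDr;
      congr (_ * _).
    move: (x 0 i) (y 0 i) (x 0 j) (y 0 j) => a b d e.
    by case: (F2P a) (F2P b) (F2P d) (F2P e) => -> [] -> [] -> [] ->;
      apply/val_inj.
  apply: F4; rewrite /r; move: E; rewrite /B.
  move: (q _) (q _) (q _) (q _) (quad_form _ _) (quad_form _ _) (quad_form _ _)
    (quad_form _ _) => a b c' d e f g h.
  by case: (F2P a) (F2P b) (F2P c') (F2P d) (F2P e) (F2P f) (F2P g) (F2P h)
    => -> [] -> [] -> [] -> [] -> [] -> [] -> [] -> // _; apply/val_inj.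
move=> x y z; change (r (x + y + z) = r x + r y + r z); rewrite !rD;
  clearbody r.
by rewrite -!addrA (addrCA (r 0)) addFF addr0.
Qed.

(** * Fixed vectors and transvections *)

(* If [L a] moves a vector [w] fixed by the other maps, then [w + L a w] is
   nonzero and fixed by [L a] as well. *)
Lemma common_fixed_vector n (T : eqType) (L : T -> bits n.+1 -> bits n.+1)
    (s : seq T) :
  (forall a, {morph L a : x y / x + y}) ->
  (forall a, involutive (L a)) ->
  (forall a b x, L a (L b x) = L b (L a x)) ->
  exists2 w, w != 0 & {in s, forall a, L a w = w}.
Proof.
move=> ML LI LC; elim: s => [|a s [w w0 Hw]].
  exists (const_mx 1) => //; apply/eqP=> /rowP/(_ 0); rewrite !mxE.
  by move/(congr1 val).
have [E|N] := eqVneq (L a w) w.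
  by exists w => // b; rewrite inE => /predU1P[->|/Hw].
exists (w + L a w : bits n.+1).
  apply: contraNneq N => /(congr1 (fun x => x + w)).
  by rewrite addrAC bitsDD !add0r => ->.
move=> b; rewrite inE => /predU1P[->|bs]; first by rewrite ML LI addrC.
by rewrite ML LC (Hw b bs).
Qed.

(* The transvection [x |-> x + l x *: (w + e)], for a functional [l] with
   [l e = l w = 1], exchanges [e] and [w]. *)
Lemma transvection n (e w : bits n) : e != 0 -> w != 0 ->
  exists t : bits n -> bits n,
    [/\ {morph t : x y / x + y}, involutive t & t e = w].
Proof.
move=> e0 w0.
have nz (x : bits n) : x != 0 -> exists i, x 0 i = 1.
  move=> /rV0Pn[i xi]; exists i.
  by case: (F2P (x 0 i)) xi => -> //; rewrite eqxx.
(* Pick [e 0 i = 1] and [w 0 j = 1]. If neither coordinate is 1 in both vectors, the sum of the two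
   coordinates is 1 on each. *)
have [l [Ml le lw]] : exists l : bits n -> 'F_2,
    [/\ {morph l : x y / x + y}, l e = 1 & l w = 1].
  have [i ei] := nz _ e0; have [j wj] := nz _ w0.
  case: (F2P (w 0 i)) => wi; last by exists (fun x => x 0 i); split=> // x y;
    rewrite mxE.
  case: (F2P (e 0 j)) => ej; last by exists (fun x => x 0 j); split=> // x y;
    rewrite mxE.
  exists (fun x => x 0 i + x 0 j); split;
    rewrite ?ei ?ej ?wi ?wj ?addr0 ?add0r //.
  by move=> x y; rewrite !mxE addrACA.
exists (fun x => x + l x *: (w + e)); split.
- by move=> x y; rewrite Ml scalerDl addrACA.
- move=> x; have l0 : l 0 = 0 by rewrite -[0]addr0 Ml addFF.
  (* [l] vanishes on [w + e], so a second application adds the same vector again. *)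
  have -> : l (x + l x *: (w + e)) = l x.
    case: (F2P (l x)) => lx; rewrite lx ?scale0r ?addr0 // scale1r !Ml le lw lx.
    exact/val_inj.
  by rewrite bitsDK.
- by rewrite le scale1r addrCA bitsDD addr0.
Qed.

(** * Splitting off the last coordinate *)

Section LastCoordinate.
Variable n : nat.

Definition restr (x : bits n.+1) : bits n := \row_j x 0 (lift ord_max j).
Definition extend (x : bits n) : bits n.+1 :=
  \row_i if unlift ord_max i is Some j then x 0 j else 0.
Definition last_unit : bits n.+1 := delta_mx 0 ord_max.
Notation e := last_unit.

Lemma restrD : {morph restr : x y / x + y}.
Proof. by move=> x y; apply/rowP=> j; rewrite !mxE. Qed.

Lemma extendD : {morph extend : x y / x + y}.
Proof.
by move=> x y; apply/rowP=> j; rewrite !mxE; case: unlift => [k|];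
  rewrite ?mxE ?addr0.
Qed.

Lemma extendK : cancel extend restr.
Proof. by move=> x; apply/rowP=> j; rewrite !mxE liftK. Qed.

Lemma restr_last : restr e = 0.
Proof.
by apply/rowP=> j; rewrite !mxE eqxx /= eq_sym (negbTE (neq_lift _ _)).
Qed.

Lemma restrZ t x : restr (t *: x) = t *: restr x.
Proof. by apply/rowP=> j; rewrite !mxE. Qed.

Lemma extend_max x : extend x 0 ord_max = 0.
Proof. by rewrite mxE unlift_none. Qed.

Lemma last_unit_max : e 0 ord_max = 1.
Proof. by rewrite mxE !eqxx. Qed.

Lemma restr_last_split x : x = extend (restr x) + x 0 ord_max *: e.
Proof.
apply/rowP=> i; rewrite !mxE eqxx /=.
case: (unliftP ord_max i) => [j|] ->; last by rewrite eqxx mulr1 add0r.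
by rewrite mxE eq_sym (negbTE (neq_lift _ _)) mulr0 addr0.
Qed.

Lemma restr_eqP x y : restr x = restr y -> x 0 ord_max = y 0 ord_max -> x = y.
Proof.
by move=> E1 E2; rewrite (restr_last_split x) (restr_last_split y) E1 E2.
Qed.

Definition lift_map (f : bits n -> bits n) (x : bits n.+1) : bits n.+1 :=
  extend (f (restr x)) + x 0 ord_max *: e.

Lemma restr_lift_map f x : restr (lift_map f x) = f (restr x).
Proof. by rewrite restrD extendK restrZ restr_last scaler0 addr0. Qed.

Lemma lift_map_max f x : lift_map f x 0 ord_max = x 0 ord_max.
Proof. by rewrite mxE extend_max add0r mxE last_unit_max mulr1. Qed.

Lemma lift_mapK f g : cancel f g -> cancel (lift_map f) (lift_map g).
Proof.
by move=> K x; apply: restr_eqP; rewrite ?restr_lift_map ?lift_map_max // K.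
Qed.

Lemma affine_lift_map f : affine f -> affine (lift_map f).
Proof.
move=> A x y z; apply: restr_eqP.
  rewrite (restrD (lift_map f x + _)) (restrD (lift_map f x)).
  by rewrite !restr_lift_map !restrD A.
have maxD (u v : bits n.+1) : (u + v) 0 ord_max = u 0 ord_max + v 0 ord_max by
  rewrite mxE.
by rewrite (maxD (lift_map f x + _)) (maxD (lift_map f x)) !lift_map_max !maxD.
Qed.

Definition extend_coef (c : 'I_n -> 'I_n -> 'F_2) (i j : 'I_n.+1) : 'F_2 :=
  if (unlift ord_max i, unlift ord_max j) is (Some i', Some j')
  then c i' j' else 0.

Lemma quad_form_extend c x :
  quad_form (extend_coef c) x = quad_form c (restr x).
Proof.
rewrite /quad_form (bigD1_ord ord_max) //= big1 ?add0r; last first.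
  by move=> j _; rewrite /extend_coef unlift_none mul0r.
apply: eq_bigr => i _; rewrite big_mkcond (bigD1_ord ord_max) //=.
rewrite {1}/extend_coef unlift_none liftK mul0r if_same add0r [RHS]big_mkcond.
(* Lifting past [ord_max] keeps the numeric value, hence also the condition [i < j]. *)
have bumpE (k : 'I_n) : bump n k = k by rewrite /bump leqNgt ltn_ord.
by apply: eq_bigr => j _; rewrite /extend_coef !liftK !mxE /= !bumpE.
Qed.

End LastCoordinate.

(** * Triangular form of the inverse permutation *)

(** All forms live in the same [n] variables; triangularity is a separate condition on the support,
    [c k i j = 0] for [k <= j]. *)
Definition triangular_map n (c : 'I_n -> 'I_n -> 'I_n -> 'F_2) (x : bits n) :
    bits n :=
  \row_k (x 0 k + quad_form (c k) x).

(** The [g a] are the translations conjugated by [s]: a simply transitive action of the additive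
    group by affine maps, whose linear parts [L a] are commuting involutions. When all [L a] fix
    [w], every [g a] commutes with the shift by [w], and carrying this through [s] gives a constant
    difference. *)
Lemma commuting_shift n (s f : bits n.+1 -> bits n.+1) :
    cancel s f -> cancel f s ->
    (forall a : bits n.+1, affine (fun v => f (s v + a))) ->
  exists w b : bits n.+1, [/\ w != 0, b != 0 & forall x, s (x + w) = s x + b].
Proof.
move=> sK fK A; pose g (a v : bits n.+1) : bits n.+1 := f (s v + a).
pose L (a v : bits n.+1) : bits n.+1 := g a v + g a 0.
have gg (a b v : bits n.+1) : g a (g b v) = g (a + b) v by rewrite /g fK
  -addrA (addrC b).
have gA a : affine (g a) := A a.
have LD a : {morph L a : x y / x + y} by apply: affine_sub0.
have LL a b v : L a (L b v) = L (a + b) v.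
  rewrite [L a]/L /L -[g b v + _]addr0 gA !gg -!addrA; congr (_ + _).
  by rewrite bitsDD addr0.
have [w w0 Hw] : exists2 w, w != 0 &
    {in enum {: bits n.+1}, forall a, L a w = w}.
  apply: common_fixed_vector => // [a x|a b x]; last by rewrite !LL addrC.
  by rewrite LL bitsDD /L /g !addr0 !sK addr0.
have Lw a : L a w = w by apply: Hw; rewrite mem_enum.
have E x : s (x + w) = s x + (s w + s 0).
  (* By transitivity [x] is the image of 0 under some [g a], so [x + w] is the image of [w]. *)
  have -> : x = g (s x + s 0) 0 by rewrite /g (addrC (s x)) bitsKD sK.
  set a := s x + s 0.
  have <- : g a w = g a 0 + w by rewrite -{2}(Lw a) /L addrC bitsDK.
  clearbody a; by rewrite /g !fK (addrC (s 0 + a)) addrA bitsDK.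
exists w, (s w + s 0); split=> //.
apply: contraNneq w0 => E0; have := E 0; rewrite E0 addr0 add0r.
by move/(can_inj sK) ->.
Qed.

Definition affine_bij n (f g : bits n -> bits n) :=
  [/\ affine f, cancel f g & cancel g f].

Lemma affine_bij_comp n (f f' g g' : bits n -> bits n) :
  affine_bij f f' -> affine_bij g g' -> affine_bij (f \o g) (g' \o f').
Proof.
by move=> [Af fK f'K] [Ag gK g'K]; split;
  [exact: affine_comp|exact: can_comp..].
Qed.

Lemma affine_bij_inv n (f g : bits n -> bits n) :
  affine_bij f g -> affine_bij g f.
Proof. by move=> [A fK gK]; split=> //; apply: affine_inv A. Qed.

Lemma affine_bij_lift n (f g : bits n -> bits n) :
  affine_bij f g -> affine_bij (lift_map f) (lift_map g).
Proof.
by move=> [A fK gK]; split; [exact: affine_lift_map|exact: lift_mapK..].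
Qed.

(** The shear changes only the last coordinate, which [l] does not read, so in characteristic 2 it
    is its own inverse. *)
Lemma affine_bij_shear n (l : bits n -> 'F_2) : affine l ->
  let f (x : bits n.+1) := x + l (restr x) *: last_unit n in affine_bij f f.
Proof.
move=> Al f; have K : involutive f.
  by move=> x; rewrite /f restrD restrZ restr_last scaler0 addr0 bitsDK.
split=> // x y z; rewrite /f !restrD Al !scalerDl.
by rewrite addrACA (addrACA x).
Qed.

(** Equivariance reduces [g] to its values at vectors with last coordinate 0: it descends to the
    quotient by the last unit vector. *)
Lemma restr_equivariant n (g : bits n.+1 -> bits n.+1) x :
    (forall x, g (x + last_unit n) = g x + last_unit n) ->
  restr (g x) = restr (g (extend (restr x))) /\
  g x 0 ord_max = g (extend (restr x)) 0 ord_max + x 0 ord_max.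
Proof.
move=> Eg; rewrite {1 3}(restr_last_split x).
have -> : g (extend (restr x) + x 0 ord_max *: last_unit n) =
    g (extend (restr x)) + x 0 ord_max *: last_unit n.
  by case: (F2P (x 0 ord_max)) => ->; rewrite ?scale0r ?addr0 // scale1r Eg.
by rewrite restrD restrZ restr_last scaler0 addr0 mxE (mxE _ _ _ ord_max)
  last_unit_max mulr1.
Qed.

(** The hypotheses survive affine changes of coordinates on both sides and the passage to the
    quotient by an invariant direction, so induction applies to the quotient map. *)
Theorem triangularize n (s f : bits n -> bits n) :
    cancel s f -> cancel f s ->
    (forall a : bits n, affine (fun v => f (s v + a))) ->
    quadratic s ->
  exists a a' b b' c,
    [/\ affine_bij a a', affine_bij b b',
        forall k i j : 'I_n, (k <= j)%N -> c k i j = 0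
      & forall x, a (s (b x)) = triangular_map c x].
Proof.
elim: n s f => [|n IH] s f sK fK A Q.
  exists id, id, id, id, (fun _ _ _ => 0); split=> // x.
  by apply/rowP=> -[].
have [w [d [w0 d0 sw]]] := commuting_shift sK fK A.
pose e := last_unit n.
have e0 : e != 0 by apply/eqP=> /rowP/(_ ord_max);
  rewrite last_unit_max mxE => /(congr1 val).
(* [t] and [u] carry [e] to [w] and [d], so [s1] below commutes with the shift by [e]. *)
have [t [Mt tK te]] := transvection e0 w0.
have [u [Mu uK ue]] := transvection e0 d0.
have At : affine_bij t t by split=> //; apply: additive_affine.
have Au : affine_bij u u by split=> //; apply: additive_affine.
pose s1 x := u (s (t x)); pose f1 x := t (f (u x)).
have s1K : cancel s1 f1 by move=> x; rewrite /s1 /f1 uK sK tK.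
have f1K : cancel f1 s1 by move=> x; rewrite /s1 /f1 tK fK uK.
have s1e x : s1 (x + e) = s1 x + e.
  by rewrite /s1 Mt te sw Mu -ue uK.
have f1e x : f1 (x + e) = f1 x + e by rewrite -{1}(f1K x) -s1e s1K.
have A1 a : affine (fun v => f1 (s1 v + a)).
  apply: (affine_eq (g := t \o ((fun v => f (s v + u a)) \o t))).
    by move=> v /=; rewrite /f1 /s1 Mu uK.
  by apply: affine_comp; [apply: additive_affine|apply: affine_comp (A _) _;
    apply: additive_affine].
have Q1 : quadratic s1.
  apply: (quadratic_postcomp (q := s \o t) Mu).
  by apply: quadratic_precomp Q; apply: additive_affine.
(* These are the maps induced on the quotient by [e], with extension by 0 as section. *)
pose s2 x := restr (s1 (extend x)); pose f2 x := restr (f1 (extend x)).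
have rs x : restr (s1 x) = s2 (restr x) by apply: (restr_equivariant x s1e).1.
have rf x : restr (f1 x) = f2 (restr x) by apply: (restr_equivariant x f1e).1.
have Aext : affine (@extend n) by apply: additive_affine; apply: extendD.
have s2K : cancel s2 f2 by move=> x; rewrite -rf s1K extendK.
have f2K : cancel f2 s2 by move=> x; rewrite -rs f1K extendK.
have A2 a : affine (fun v => f2 (s2 v + a)).
  apply: (affine_eq (g := @restr n \o ((fun v => f1 (s1 v + extend a)) \o
    @extend n))).
    by move=> v /=; rewrite rf restrD extendK.
  apply: affine_comp; first by apply: additive_affine; apply: restrD.
  exact: affine_comp (A1 _) Aext.
have Q2 : quadratic s2.
  apply: (quadratic_postcomp (q := s1 \o @extend n) (@restrD n)).
  exact: quadratic_precomp Q1.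
have [a [a' [b [b' [c [Ha Hb Hc E]]]]]] := IH s2 f2 s2K f2K A2 Q2.
(* The contribution of the first [n] coordinates to the last output coordinate, after the change [b]
   of the source. *)
pose q x := s1 (extend (b x)) 0 ord_max.
have Qq : quadratic q.
  have [Ab _ _] := Hb.
  apply: (quadratic_postcomp (q := s1 \o (@extend n \o b))
    (b := fun x : bits n.+1 => x 0 ord_max)).
    by move=> x y; rewrite mxE.
  by apply: quadratic_precomp Q1; apply: affine_comp.
have [cq Al] := quadratic_expand Qq.
(* [l] is the affine remainder of [q]. The shear [g] adds it to the last source coordinate,
   equivariance carries it to the output, and there only [quad_form cq] remains. *)
set l := (fun x => _) in Al.
pose g (x : bits n.+1) := x + l (restr x) *: e.
have Hg : affine_bij g g := affine_bij_shear Al.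
exists (lift_map a \o u), (u \o lift_map a'), (t \o (lift_map b \o g)),
  ((g \o lift_map b') \o t),
  (fun k => if unlift ord_max k is Some k' then extend_coef (c k') else
    extend_coef cq).
split.
- exact: affine_bij_comp (affine_bij_lift Ha) Au.
- by apply: affine_bij_comp At (affine_bij_comp _ Hg); apply: affine_bij_lift.
- move=> k i j.
  case: (unliftP ord_max k) => [k'|] ->; rewrite /extend_coef.
    case: (unliftP ord_max j) => [j'|] ->; last by case: unlift.
    rewrite !lift_max => kj; case: unlift => // i'; exact: Hc.
  (* In the new row only [j = ord_max] has to be checked, and extended coefficients are 0 there. *)
  move=> mj; have -> : j = ord_max by apply/val_inj/eqP;
    rewrite eqn_leq mj -ltnS ltn_ord.
  by rewrite unlift_none; case: unlift.
- move=> x /=; rewrite -/(s1 _).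
  have rg : restr (g x) = restr x by rewrite /g restrD restrZ restr_last
    scaler0 addr0.
  apply/rowP=> k; rewrite [RHS]mxE.
  case: (unliftP ord_max k) => [k'|] ->.
    rewrite quad_form_extend.
    transitivity (restr (lift_map a (s1 (lift_map b (g x)))) 0 k');
      first by rewrite [in RHS]mxE.
    by rewrite restr_lift_map rs restr_lift_map rg E !mxE.
  rewrite quad_form_extend lift_map_max (restr_equivariant _ s1e).2.
  rewrite restr_lift_map rg lift_map_max -/(q _) /g mxE (mxE _ _ _ ord_max)
    last_unit_max mulr1 /l.
  by rewrite addrCA (addrA (q _)) addFF add0r.
Qed.

(** * Monomial operators *)

Section Operators.
Variable C : numClosedFieldType.

(** The nontrivial additive character of ['F_2]. *)
Definition chi (x : 'F_2) : C := (-1) ^+ x.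

Lemma chiD x y : chi (x + y) = chi x * chi y.
Proof.
by case: (F2P x) (F2P y) => -> [] ->;
  rewrite /chi /= ?mulr1 ?mul1r // mulrNN mulr1.
Qed.

Lemma chi0 : chi 0 = 1. Proof. by []. Qed.

Lemma chi_sqr x : chi x * chi x = 1.
Proof. by rewrite -chiD addFF. Qed.

Lemma chi_neq0 x : chi x != 0.
Proof.
by apply: contra_eq_neq (chi_sqr x) => ->; rewrite mul0r eq_sym oner_eq0.
Qed.

Lemma chi_conj x : (chi x)^* = chi x.
Proof.
by case: (F2P x) => ->; rewrite /chi /= ?expr0 ?expr1 ?rmorphN rmorph1.
Qed.

Lemma chi_inj : injective chi.
Proof.
have N : (-1 : C) != 1 by rewrite eq_sym -subr_eq0 opprK -(natrD _ 1 1)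
  pnatr_eq0.
move=> x y; case: (F2P x) (F2P y) => -> [] -> //; rewrite /chi /= => /eqP;
  by rewrite ?(negbTE N) // eq_sym (negbTE N).
Qed.

(** One shape for permutation gates, Paulis, diagonal sign gates and their conjugates; products and
    adjoints are computed on [f] and [s]. *)
Definition monomial n (f : bits n -> bits n) (s : bits n -> C) : operator C n :=
  \matrix_(a, b) ((basis_label a == f (basis_label b))%:R * s (basis_label b)).

Section Monomial.
Variable n : nat.
Implicit Types (f g : bits n -> bits n) (s t : bits n -> C).

Lemma eq_monomial f g s t : f =1 g -> s =1 t -> monomial f s = monomial g t.
Proof. by move=> E F; apply/matrixP=> a b; rewrite !mxE E F. Qed.

Lemma basis_map_monomial f : basis_map_op C f = monomial f (fun=> 1).
Proof. by apply/matrixP=> a b; rewrite !mxE mulr1. Qed.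

Lemma monomialM f g s t :
  monomial f s *m monomial g t = monomial (f \o g) (fun v => s (g v) * t v).
Proof.
apply/matrixP=> a b; rewrite !mxE (bigD1 (enum_rank (g (basis_label b)))) //=.
rewrite !mxE /basis_label enum_rankK eqxx mul1r mulrA big1 ?addr0 // => c nc.
rewrite !mxE; case: (basis_label c =P g (basis_label b)) => [E|_];
  last by rewrite mul0r mulr0.
by case/eqP: nc; rewrite -E /basis_label enum_valK.
Qed.

Lemma monomial1 : monomial (@id (bits n)) (fun=> 1) = 1%:M.
Proof.
by apply/matrixP=> a b; rewrite !mxE mulr1 /basis_label (inj_eq enum_val_inj).
Qed.

Lemma monomial_adjoint f g s : cancel f g -> cancel g f ->
  (monomial f s)^t* = monomial g (fun v => (s (g v))^*).
Proof.
move=> fK gK; apply/matrixP=> a b; rewrite !mxE rmorphM /= conjC_nat.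
rewrite -(can2_eq fK gK) eq_sym; case: eqP => [<-|_]; last by rewrite !mul0r.
by rewrite fK.
Qed.

(** In the column of [v] the only nonzero entry is [s v], in the row of [f v]; its position gives
    [f] and its value gives [s]. *)
Lemma monomial_inj f g s t : (forall v, s v != 0) ->
  monomial f s = monomial g t -> f =1 g /\ s =1 t.
Proof.
move=> s0 /matrixP E.
have fg v : f v = g v.
  have := E (enum_rank (f v)) (enum_rank v);
    rewrite !mxE /basis_label !enum_rankK eqxx mul1r.
  by case: eqP => // _; rewrite mul0r => /eqP; rewrite (negbTE (s0 v)).
split=> // v.
have := E (enum_rank (f v)) (enum_rank v);
  rewrite !mxE /basis_label !enum_rankK.
by rewrite fg eqxx !mul1r.
Qed.

Lemma monomial_unitary f g s : cancel f g -> cancel g f ->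
  (forall v, s v * (s v)^* = 1) -> monomial f s \is unitarymx.
Proof.
move=> fK gK s1; apply/unitarymxP;
  rewrite (monomial_adjoint _ fK gK) monomialM -monomial1.
by apply: eq_monomial => v /=; rewrite ?gK ?s1.
Qed.

Lemma monomial_conj f g s P h t : cancel f g -> cancel g f ->
  P = monomial h t ->
  monomial f s *m P *m (monomial f s)^t* =
  monomial (fun v => f (h (g v)))
    (fun v => s (h (g v)) * t (g v) * (s (g v))^*).
Proof. by move=> fK gK ->; rewrite (monomial_adjoint _ fK gK) !monomialM. Qed.

(** * The Pauli group as monomial operators *)

(** Being a fourth root of unity is visibly stable under products and inverses, unlike membership in
    the list. *)
Lemma quarter_phase (c : C) : (c \in [:: 1; -1; 'i; - 'i]) = (c ^+ 4 == 1).
Proof.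
have -> : c ^+ 4 = (c ^+ 2) ^+ 2 by rewrite -exprM.
have E : (c ^+ 2 == -1) = (c == 'i) || (c == - 'i) by rewrite -sqrCi eqf_sqr.
by rewrite sqrf_eq1 E sqrf_eq1 !inE !orbA.
Qed.

(* The Pauli Y is i X Z, hence the phase 'i ^+ (x * z) in front of [pauliXZ x z]. *)
Definition pauliXZ (x z : 'F_2) : 'M[C]_2 :=
  \matrix_(a, b) (((a : 'F_2) == (b : 'F_2) + x)%:R * chi (z * b)).

Lemma pauli_factorP (p : 'M[C]_2) :
  p \in [:: 1%:M; pauliX C; pauliY C; pauliZ C] <->
  exists x z : 'F_2, p = 'i ^+ (x * z)%R *: pauliXZ x z.
Proof.
have e2 (q r : 'M[C]_2) : (forall a b : 'F_2, q a b = r a b) -> q = r.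
  by move=> E; apply/matrixP=> a b; apply: E.
have EI : 1%:M = 'i ^+ (0 * 0 : 'F_2)%R *: pauliXZ 0 0.
  by apply: e2 => a b; case: (F2P a) (F2P b) => -> [] ->;
    rewrite !mxE /chi /= ?expr0 ?expr1 ?mul1r ?mulr1 ?mul0r ?mulr0.
have EX : pauliX C = 'i ^+ (1 * 0 : 'F_2)%R *: pauliXZ 1 0.
  by apply: e2 => a b; case: (F2P a) (F2P b) => -> [] ->;
    rewrite !mxE /chi /= ?expr0 ?expr1 ?mul1r ?mulr1 ?mul0r ?mulr0.
have EY : pauliY C = 'i ^+ (1 * 1 : 'F_2)%R *: pauliXZ 1 1.
  by apply: e2 => a b; case: (F2P a) (F2P b) => -> [] ->;
    rewrite !mxE /chi /= ?expr0 ?expr1 ?mul1r ?mulr1 ?mul0r ?mulr0 ?mulrN1.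
have EZ : pauliZ C = 'i ^+ (0 * 1 : 'F_2)%R *: pauliXZ 0 1.
  by apply: e2 => a b; case: (F2P a) (F2P b) => -> [] ->;
    rewrite !mxE /chi /= ?expr0 ?expr1 ?mul1r ?mulr1 ?mul0r ?mulr0.
split=> [|[x [z ->]]].
  rewrite !inE => /or4P[]/eqP->.
  - by exists 0, 0.
  - by exists 1, 0.
  - by exists 1, 1.
  - by exists 0, 1.
case: (F2P x) (F2P z) => -> [] ->;
  rewrite -?EI -?EX -?EY -?EZ !inE eqxx ?orbT //.
Qed.

Lemma tensor_pauliXZ (al be : 'I_n -> 'F_2) (k : 'I_n -> C) :
  tensor_op (fun j => k j *: pauliXZ (al j) (be j)) =
  monomial (fun v => v + \row_j al j)
    (fun v => (\prod_j k j) * chi (\sum_j v 0 j * be j)).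
Proof.
apply/matrixP=> a b; rewrite !mxE.
set v := basis_label a; set w := basis_label b.
rewrite (eq_bigr (fun j =>
  k j * ((v 0 j == w 0 j + al j)%:R * chi (be j * w 0 j)))); last first.
  by move=> j _; rewrite !mxE.
rewrite !big_split /= mulrCA; congr (_ * _); last first.
  rewrite (big_morph chi chiD chi0); congr (_ * _).
  by apply: eq_bigr => j _; rewrite mulrC.
case: eqP => [E|N]; first by rewrite big1 // => j _; rewrite E !mxE eqxx.
have [j nj] : exists j, v 0 j != w 0 j + al j.
  apply/existsP; apply: contra_notT N; rewrite negb_exists => /forallP H.
  by apply/rowP=> j; rewrite !mxE; apply/eqP; rewrite -[_ == _]negbK H.
by rewrite (bigD1 j) //= (negbTE nj) mul0r.
Qed.

(** The X exponents of the factors are the coordinates of the translation and the Z exponents the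
    coefficients of the functional; the powers of ['i] from the Y factors go into the scalar. *)
Lemma pauliP (U : operator C n) : pauli_group U <->
  exists c a (h : bits n -> 'F_2), [/\ c ^+ 4 = 1, {morph h : x y / x + y}
    & U = monomial (fun v => v + a) (fun v => c * chi (h v))].
Proof.
have i4 m : ('i ^+ m : C) ^+ 4 = 1.
  by rewrite -exprM mulnC exprM (exprM _ 2 2) sqrCi sqrrN !expr1n.
have prod4 (k : 'I_n -> C) : (forall j, k j ^+ 4 = 1) -> (\prod_j k j) ^+ 4 = 1.
  by move=> K; rewrite -prodrXl big1.
split=> [[c [P [cP PP ->]]]|[c [a [h [c4 Mh ->]]]]].
  have /fin_all_exists[al /fin_all_exists[be Pab]] := fun j => (pauli_factorP
    (P j)).1 (PP j).
  pose k j : C := 'i ^+ (al j * be j)%R.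
  exists (c * \prod_j k j), (\row_j al j), (fun v => \sum_j v 0 j * be j);
    split.
  - rewrite exprMn prod4 ?mulr1 => [|j]; last exact: i4.
    by apply/eqP; rewrite -quarter_phase.
  - move=> x y; rewrite -big_split; apply: eq_bigr => j _.
    by rewrite mxE mulrDl.
  - have -> : tensor_op P = tensor_op (fun j => k j *: pauliXZ (al j) (be j)).
      by apply/matrixP=> u v; rewrite !mxE; apply: eq_bigr => j _; rewrite Pab.
    rewrite tensor_pauliXZ; apply/matrixP=> u v; rewrite !mxE.
    by rewrite mulrCA !mulrA.
pose al j := a 0 j; pose be j := h (unitb j).
pose k j : C := 'i ^+ (al j * be j)%R.
have K4 : (\prod_j k j) ^+ 4 = 1 by apply: prod4 => j; apply: i4.
(* The division compensates for the powers of ['i] contributed by the tensor factors. *)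
exists (c / \prod_j k j), (fun j => k j *: pauliXZ (al j) (be j)); split.
- by rewrite quarter_phase exprMn exprVn K4 c4 invr1 mulr1.
- by move=> j; apply/pauli_factorP; exists (al j), (be j).
- have K0 : \prod_j k j != 0.
    by apply: contra_eq_neq K4 => ->; rewrite expr0n eq_sym oner_eq0.
  rewrite tensor_pauliXZ; apply/matrixP=> u v;
    rewrite !mxE (additive_expand Mh).
  rewrite [RHS]mulrCA (mulrA (c / _)) divfK //; congr (_ * _);
    congr (nat_of_bool _)%:R.
  by congr (_ == _ + _); apply/rowP=> j; rewrite mxE.
Qed.

(** * Permutation gates in the Clifford hierarchy *)

Implicit Types (U V : operator C n).

Lemma conj_mulmx U V (P : operator C n) :
  (U *m V) *m P *m (U *m V)^t* = U *m (V *m P *m V^t*) *m U^t*.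
Proof. by rewrite trmx_mul map_mxM !mulmxA. Qed.

Lemma clifford2M U V : clifford_hierarchy 2 U -> clifford_hierarchy 2 V ->
  clifford_hierarchy 2 (U *m V).
Proof.
move=> [UU HU] [UV HV]; split; first exact: mul_unitarymx.
by move=> P PP; rewrite conj_mulmx; apply/HU/HV.
Qed.

Lemma clifford3_mulr U V : clifford_hierarchy 3 U -> clifford_hierarchy 2 V ->
  clifford_hierarchy 3 (U *m V).
Proof.
move=> [UU HU] [UV HV]; split; first exact: mul_unitarymx.
by move=> P PP; rewrite conj_mulmx; apply/HU/HV.
Qed.

(** The conjugated Pauli is a product of three Clifford operators, the last of which is the adjoint
    of [U]; hence the second hypothesis. *)
Lemma clifford3_mull U V :
  clifford_hierarchy 2 U -> clifford_hierarchy 2 (U^t*) ->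
  clifford_hierarchy 3 V -> clifford_hierarchy 3 (U *m V).
Proof.
move=> HU HU' [UV HV]; split; first by apply: mul_unitarymx => //; case: HU.
move=> P /HV H; rewrite conj_mulmx.
by do 2 (apply: clifford2M => //).
Qed.

Lemma permutation_gateP U : permutation_gate U <->
  exists f g, [/\ cancel f g, cancel g f & U = basis_map_op C f].
Proof.
split=> [[_ /existsP/= H]|[f [g [fK gK ->]]]].
  have [p /eqP ->] : exists p, U == perm_mx p by [].
  (* [perm_mx p] has its ones at [(i, p i)], so the one in column [b] lies in row [p^-1 b]. *)
  exists (fun v => enum_val ((p^-1)%g (enum_rank v))),
    (fun v => enum_val (p (enum_rank v))).
  split=> [v|v|]; rewrite ?enum_valK ?permKV ?permK ?enum_rankK //.
  apply/matrixP=> a b; rewrite !mxE /basis_label enum_valK (inj_eq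
    enum_val_inj).
  by rewrite -(can2_eq (permK p) (permKV p)).
split; first by rewrite basis_map_monomial (monomial_unitary fK gK) // => v;
  rewrite mul1r conjC1.
apply/is_perm_mxP; have fI : injective (fun a : 'I_(qdim n) => enum_rank (g
  (enum_val a))).
  by move=> a b /enum_rank_inj/(can_inj gK)/enum_val_inj.
exists (perm fI); apply/matrixP=> a b; rewrite !mxE permE /basis_label.
by rewrite (can2_eq (@enum_rankK _) (@enum_valK _)) (can2_eq gK fK).
Qed.

Lemma pauli_translation (a : bits n) :
  pauli_group (basis_map_op C (fun v => v + a)).
Proof.
apply/pauliP; exists 1, a, (fun=> 0); split=> [|x y|];
  rewrite ?expr1n ?addr0 //.
by rewrite basis_map_monomial; apply: eq_monomial => // v; rewrite chi0 mulr1.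
Qed.

Lemma pauli_phase (h : bits n -> 'F_2) : {morph h : x y / x + y} ->
  pauli_group (monomial id (chi \o h)).
Proof.
move=> Mh; apply/pauliP; exists 1, 0, h; split=> //; first exact: expr1n.
by apply: eq_monomial => v; rewrite ?addr0 //= mul1r.
Qed.

Lemma basis_map_conj f g P h t : cancel f g -> cancel g f -> P = monomial h t ->
  basis_map_op C f *m P *m (basis_map_op C f)^t* =
  monomial (fun v => f (h (g v))) (fun v => t (g v)).
Proof.
move=> fK gK ->; rewrite basis_map_monomial (monomial_conj _ fK gK (erefl _)).
by apply: eq_monomial => // v; rewrite mul1r conjC1 mulr1.
Qed.

(** The conjugate of a translation is a Pauli whose underlying map must again be a translation, so
    [f] turns shifts into shifts. *)
Lemma clifford2_affine f g : cancel f g -> cancel g f ->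
  clifford_hierarchy 2 (basis_map_op C f) -> affine f.
Proof.
move=> fK gK [_ H].
have E a : exists a', forall v, f (v + a) = f v + a'.
  have /pauliP[c [a' [h [_ _]]]] := H _ (pauli_translation a).
  rewrite (basis_map_conj fK gK (basis_map_monomial _)) => /monomial_inj[v|E _].
    exact: oner_neq0.
  by exists a' => v; rewrite -E fK.
move=> x y z; have [[b Eb] [c Ec]] := (E y, E z).
by rewrite Ec Eb -[y]add0r -[z]add0r Eb Ec -!addrA (addrCA b) bitsKD.
Qed.

Lemma affine_clifford2 f g :
  affine_bij f g -> clifford_hierarchy 2 (basis_map_op C f).
Proof.
move=> [Af fK gK]; have Ag := affine_inv fK gK Af.
split.
  by rewrite basis_map_monomial (monomial_unitary fK gK) // => v;
    rewrite mul1r conjC1.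
move=> P /pauliP[c [a [h [c4 Mh EP]]]]; apply/pauliP.
have h0 : h 0 = 0 by rewrite -[0]addr0 Mh addFF.
(* The affine functional [h \o g] splits into its constant, absorbed by the phase, and its linear
   part. *)
exists (c * chi (h (g 0))), (f a + f 0), (fun v => h (g v + g 0)); split.
- by rewrite exprMn c4 mul1r -[4%N]/(2 * 2)%N exprM (expr2 (chi _)) chi_sqr
  expr1n.
- by move=> x y; rewrite -Mh (affine_sub0 Ag).
rewrite (basis_map_conj fK gK EP); apply: eq_monomial => v;
  first by rewrite (affine_shift _ _ Af) gK.
by rewrite -mulrA -chiD -Mh addrCA bitsDD addr0.
Qed.

(** Conjugating the translation by [a] produces the phase [chi] of the derivative of [q] along [a],
    which for a Pauli is a constant times a linear character. *)
Lemma clifford2_quadratic (q : bits n -> 'F_2) :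
  clifford_hierarchy 2 (monomial id (chi \o q)) -> quadratic q.
Proof.
move=> [_ H] a.
have /pauliP[c [a' [h [_ Mh]]]] := H _ (pauli_translation a).
have idK : cancel (@id (bits n)) id by [].
rewrite (monomial_conj _ idK idK (basis_map_monomial _)) => /monomial_inj[v|_
  E].
  by rewrite mulr1 mulf_neq0 // ?chi_conj chi_neq0.
have Eq v : c * chi (h v) = chi (q v + q (v + a)).
  by rewrite -E mulr1 /= chi_conj -chiD addrC.
have h0 : h 0 = 0 by rewrite -[0]addr0 Mh addFF.
(* At [v = 0] the constant [c] is seen to be a sign, so the equation between phases lifts to
   ['F_2]. *)
have Ec : c = chi (q 0 + q (0 + a)) by rewrite -Eq h0 mulr1.
set d := _ + _ in Ec.
have Eh v : q v + q (v + a) = d + h v.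
  by apply: chi_inj; rewrite -Eq Ec chiD.
move=> x y z; rewrite !Eh !Mh.
move: (h x) (h y) (h z) d {Ec Eh} => b1 b2 b3 b4.
by case: (F2P b1) (F2P b2) (F2P b3) (F2P b4) => -> [] -> [] -> [] ->;
  apply/val_inj.
Qed.

Lemma clifford3_translation f g : cancel f g -> cancel g f ->
  clifford_hierarchy 3 (basis_map_op C f) ->
  forall a : bits n, affine (fun v => f (g v + a)).
Proof.
move=> fK gK [_ H] a; have := H _ (pauli_translation a).
rewrite (basis_map_conj fK gK (basis_map_monomial _)) -basis_map_monomial.
apply: (@clifford2_affine _ (fun v => f (g v + a))) => v;
  by rewrite fK bitsDK gK.
Qed.

(** Conjugating Z on qubit [j] gives the diagonal gate whose sign is [chi] of coordinate [j] of
    [g]. *)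
Lemma clifford3_quadratic f g : cancel f g -> cancel g f ->
  clifford_hierarchy 3 (basis_map_op C f) -> quadratic g.
Proof.
move=> fK gK [_ H] a x y z; apply/rowP=> j.
have Mj : {morph (fun v : bits n => v 0 j) : x y / x + y} by move=> u v;
  rewrite mxE.
have := H _ (pauli_phase Mj); rewrite (basis_map_conj fK gK (erefl _)).
rewrite (eq_monomial gK (t := chi \o (fun v => g v 0 j))) //.
by move/clifford2_quadratic/(_ a x y z); rewrite !mxE.
Qed.

End Monomial.

(** * Toffoli circuits in staircase form *)

Section Circuits.
Variable n : nat.
Implicit Types (t : 'I_n * 'I_n * 'I_n) (s : seq ('I_n * 'I_n * 'I_n)).

Definition circuit_fun s (v : bits n) : bits n :=
  foldl (fun w t => toffoli_fun t w) v s.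

Lemma toffoli_circuitE s : toffoli_circuit C s = basis_map_op C (circuit_fun s).
Proof.
elim/last_ind: s => [|s t IH].
  by rewrite /toffoli_circuit /= basis_map_monomial -monomial1.
rewrite /toffoli_circuit foldl_rcons -/(toffoli_circuit C s) IH /toffoli
  !basis_map_monomial monomialM.
by apply: eq_monomial => v; rewrite ?mulr1 // /circuit_fun foldl_rcons.
Qed.

Definition target_block (c : 'I_n -> 'I_n -> 'I_n -> 'F_2) (k : 'I_n) :=
  [seq (p.1, p.2, k) | p : 'I_n * 'I_n <- enum {: 'I_n * 'I_n}
    & (p.1 < p.2 < k)%N && (c k p.1 p.2 != 0)].

Definition staircase_of c : seq ('I_n * 'I_n * 'I_n) :=
  flatten [seq target_block c k | k <- enum 'I_n].

Lemma mem_staircase_of c t : (t \in staircase_of c) =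
  (t.1.1 < t.1.2 < t.2)%N && (c t.2 t.1.1 t.1.2 != 0).
Proof.
apply/flattenP/idP => [[_ /mapP[k _ ->] /mapP[p]]|H].
  by rewrite mem_filter => /andP[H _] ->.
exists (target_block c t.2); first by apply: map_f; rewrite mem_enum.
apply/mapP; exists t.1; last by case: t {H} => -[].
by rewrite mem_filter H mem_enum.
Qed.

Lemma circuit_fun_cat s1 s2 v :
  circuit_fun (s1 ++ s2) v = circuit_fun s2 (circuit_fun s1 v).
Proof. by rewrite /circuit_fun foldl_cat. Qed.

(** The controls lie below the target, so no gate of the block changes what another one reads, and
    the increments add up. *)
Lemma circuit_block (k : 'I_n) (l : seq ('I_n * 'I_n)) v :
    all (fun p : 'I_n * 'I_n => p.1 < p.2 < k)%N l ->
  circuit_fun [seq (p.1, p.2, k) | p <- l] v =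
  v + (\sum_(p <- l) v 0 p.1 * v 0 p.2) *: unitb k.
Proof.
elim/last_ind: l => [|l [i j] IH]; first by rewrite big_nil scale0r addr0.
rewrite all_rcons => /andP[/= /andP[ij jk] /IH{}IH].
rewrite map_rcons /circuit_fun foldl_rcons -/(circuit_fun _ _) IH.
have nk (m : 'I_n) : (m < k)%N -> (m == k) = false.
  by move=> mk; apply/eqP=> E; rewrite E ltnn in mk.
apply/rowP=> m; rewrite -cats1 big_cat big_seq1 /= !mxE !eqxx /=.
rewrite (nk i) ?(ltn_trans ij) // (nk j) // !mulr0 !addr0.
case: eqP => [->|_]; last by rewrite !mulr0.
by rewrite !mulr1 addrA.
Qed.

Lemma quad_form_local (c : 'I_n -> 'I_n -> 'F_2) (k : 'I_n) (x y : bits n) :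
    (forall i j : 'I_n, (k <= j)%N -> c i j = 0) ->
    (forall j : 'I_n, (j < k)%N -> x 0 j = y 0 j) ->
  quad_form c x = quad_form c y.
Proof.
move=> Hc E; apply: eq_bigr => i _; apply: eq_bigr => j ij.
have [/Hc->|jk] := leqP k j; first by rewrite !mul0r.
by rewrite !E // (ltn_trans ij).
Qed.

Section StaircaseOf.
Variable c : 'I_n -> 'I_n -> 'I_n -> 'F_2.
Hypothesis c_supp : forall k i j : 'I_n, (k <= j)%N -> c k i j = 0.

Lemma circuit_target_block k v :
  circuit_fun (target_block c k) v = v + quad_form (c k) v *: unitb k.
Proof.
rewrite circuit_block; last first.
  by apply/allP=> p; rewrite mem_filter => /andP[/andP[]].
congr (_ + _ *: _); rewrite big_filter big_enum_cond /= /quad_form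
  pair_big_dep /=.
rewrite big_mkcond [RHS]big_mkcond /=; apply: eq_bigr => -[i j] _ /=.
(* A pair [i < j] omitted from the block has coefficient 0, by the filter or by [c_supp]. *)
case: (ltnP i j) => //= ij; have [/c_supp->|jk] := leqP k j;
  first by rewrite mul0r.
by case: (F2P (c k i j)) => ->; rewrite ?mul0r //= mul1r.
Qed.

(* A block only reads coordinates below its target, which are final when it is
   reached: the increments can all be evaluated at the final state [z]. *)
Lemma circuit_blocks (ks : seq 'I_n) v : sorted ltn [seq val k | k <- ks] ->
  let z := circuit_fun (flatten [seq target_block c k | k <- ks]) v in
  forall k, z 0 k = v 0 k + if k \in ks then quad_form (c k) z else 0.
Proof.
elim/last_ind: ks => [|ks m IH] /=; first by move=> _ k; rewrite addr0.
rewrite map_rcons sorted_pairwise; last exact: ltn_trans.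
rewrite -cats1 pairwise_cat allrel1r => /and3P[/allP lt_m pw _] k.
rewrite map_rcons flatten_rcons circuit_fun_cat circuit_target_block.
rewrite -sorted_pairwise in pw; last exact: ltn_trans.
have {IH} := IH pw; set z := circuit_fun _ v => IH.
have ltm k' : k' \in ks -> (k' < m)%N by move=> k'ks; apply: lt_m; apply: map_f.
(* The new block changes only coordinate [m], which forms with target at most [m] do not read. *)
have Eq (k' : 'I_n) : (k' <= m)%N ->
    quad_form (c k') (z + quad_form (c m) z *: unitb m) = quad_form (c k') z.
  move=> km; apply: (quad_form_local (k := k')) => [i j|j jk];
    first exact: c_supp.
  rewrite !mxE eqxx /=; case: eqP => [E|_]; last by rewrite mulr0 addr0.
  by move: jk; rewrite E ltnNge km.
rewrite mxE mxE [unitb m _ _]mxE eqxx /= IH mem_rcons inE.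
have [->|km] := eqVneq k m.
  rewrite Eq // mulr1; case: ifP => [/ltm|_]; first by rewrite ltnn.
  by rewrite addr0.
by rewrite mulr0 addr0 /=; case: ifP => // /ltm/ltnW/Eq->.
Qed.

(** With all targets listed, the final state [z] satisfies [z 0 k = v 0 k + quad_form (c k) z];
    adding the form once more recovers [v]. *)
Lemma circuit_staircase_of :
  cancel (circuit_fun (staircase_of c)) (triangular_map c).
Proof.
move=> v; apply/rowP=> k; rewrite mxE (circuit_blocks (ks := enum 'I_n))
  ?mem_enum.
  by rewrite -addrA addFF addr0.
by rewrite val_enum_ord iota_ltn_sorted.
Qed.

(** Distinctness in [staircase] concerns operators, not triples. On the vector with ones exactly at
    [i] and [j] the first gate flips bit [k]; for the second to do so, its target must be [k] and
    its ordered controls [i] and [j]. *)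
Lemma toffoli_inj (i j k i' j' k' : 'I_n) : (i < j < k)%N -> (i' < j' < k')%N ->
  toffoli C (i, j, k) = toffoli C (i', j', k') -> (i, j, k) = (i', j', k').
Proof.
move=> /andP[ij jk] /andP[ij' jk'].
rewrite /toffoli !basis_map_monomial => /monomial_inj[v|E _];
  first exact: oner_neq0.
have neq (a b : 'I_n) : (a < b)%N -> (a == b) = false.
  by move=> ab; apply/eqP=> E'; rewrite E' ltnn in ab.
pose v : bits n := unitb i + unitb j.
have vE m : v 0 m = ((m == i) || (m == j))%:R.
  rewrite !mxE !eqxx /=; case: (m =P i) => [Ei|_]; case: (m =P j) => [Ej|_];
    rewrite ?addr0 ?add0r //.
  by rewrite -Ei Ej ltnn in ij.
have vk : v 0 k = 0 by rewrite vE ![k == _]eq_sym (neq i k) ?(ltn_trans ij) //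
  (neq j k).
clearbody v; have := congr1 (fun w : bits n => w 0 k) (E v);
  rewrite /toffoli_fun !mxE eqxx vk.
rewrite (vE i) (vE j) !eqxx orbT mulr1 add0r.
case: (k =P k') => [<-|_] /= kk //; move: kk; rewrite vk add0r (vE i') (vE j').
case Hi: ((i' == i) || _); last by rewrite mul0r.
case Hj: ((j' == i) || _); last by rewrite mulr0.
case/orP: Hi ij' => /eqP->; case/orP: Hj => /eqP-> //; rewrite ?ltnn //.
by move=> ji; have := ltn_trans ij ji; rewrite ltnn.
Qed.

Lemma sorted_targets (ks : seq 'I_n) : sorted ltn [seq val k | k <- ks] ->
  sorted leq [seq val t.2 | t <- flatten [seq target_block c k | k <- ks]].
Proof.
rewrite (sorted_pairwise ltn_trans) (sorted_pairwise leq_trans).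
elim: ks => //= k ks IH /andP[/allP lt_k /IH{}IH].
rewrite map_cat pairwise_cat IH andbT; apply/andP; split.
  apply/allrelP => _ _ /mapP[t /mapP[p _ ->] ->] /mapP[_ /flattenP[_ /mapP[k'
    k'ks ->] /mapP[p' _ ->]] ->] /=.
  by apply: ltnW; apply: lt_k; apply: map_f.
rewrite /target_block; elim: [seq p <- _ | _] => //= p l ->; rewrite andbT.
by apply/allP=> _ /mapP[_ /mapP[p' _ ->] ->] /=.
Qed.

Lemma uniq_staircase_of : uniq (staircase_of c).
Proof.
apply: (@allpairs_uniq_dep _ _ _ (fun k p => (p.1, p.2, k))).
- exact: enum_uniq.
- by move=> k _; rewrite filter_uniq ?enum_uniq.
- by move=> [k [i j]] [k' [i' j']] _ _ /= [-> -> ->].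
Qed.

Lemma staircase_staircase_of : staircase C (staircase_of c).
Proof.
have lt t : t \in staircase_of c -> (t.1.1 < t.1.2 < t.2)%N.
  by rewrite mem_staircase_of => /andP[].
apply/and3P; split.
- rewrite map_inj_in_uniq ?uniq_staircase_of // => -[[i j] k] [[i' j'] k']
  /lt/= H /lt/= H'.
  exact: toffoli_inj.
- by apply/allP=> -[[i j] k] /lt.
- by apply: sorted_targets; rewrite val_enum_ord iota_ltn_sorted.
Qed.

End StaircaseOf.
End Circuits.

(** * Factorization of the gate *)

Lemma clifford_permutation_affine n (f g : bits n -> bits n) :
  affine_bij f g -> clifford_permutation (basis_map_op C f).
Proof.
move=> H; split; last exact: affine_clifford2 H.
by apply/permutation_gateP; have [_ fK gK] := H; exists f, g.
Qed.

Lemma basis_map_op_comp n (f g : bits n -> bits n) :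
  basis_map_op C f *m basis_map_op C g = basis_map_op C (f \o g).
Proof.
by rewrite !basis_map_monomial monomialM; apply: eq_monomial => // v;
  rewrite mulr1.
Qed.

Lemma eq_basis_map_op n (f g : bits n -> bits n) :
  f =1 g -> basis_map_op C f = basis_map_op C g.
Proof. by move=> E; rewrite !basis_map_monomial; apply: eq_monomial. Qed.

(** The triangular map is [a \o g \o b] and the staircase circuit [m] inverts it, so
    [m = b' \o f \o a']. Hence [f = b \o m \o a], and [m] stays in the third level because the outer
    factors are Clifford. *)
Lemma clifford3_staircase n (pi : operator C n) :
  permutation_gate pi -> clifford_hierarchy 3 pi ->
  exists phi1 phi2 mu : operator C n,
    [/\ clifford_permutation phi1,
        clifford_permutation phi2,
        permutation_gate mu
        /\ (exists s : seq ('I_n * 'I_n * 'I_n),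
              staircase C s /\ mu = toffoli_circuit C s),
        clifford_hierarchy 3 mu
      & pi = phi1 *m mu *m phi2].
Proof.
move=> /permutation_gateP[f [g [fK gK ->]]] H3.
have [a [a' [b [b' [c [Ha Hb c0 E]]]]]] := triangularize gK fK
  (clifford3_translation fK gK H3) (clifford3_quadratic fK gK H3).
have [[_ aK a'K] [_ bK b'K]] := (Ha, Hb).
pose m := circuit_fun (staircase_of c).
have mK : cancel m (triangular_map c) := circuit_staircase_of c0.
have mE x : m x = b' (f (a' x)) by rewrite -{2}(mK x) -E aK gK bK.
have fE y : f y = b (m (a y)) by rewrite mE aK b'K.
exists (basis_map_op C b), (basis_map_op C a), (basis_map_op C m); split.
- exact: clifford_permutation_affine Hb.
- exact: clifford_permutation_affine Ha.
- split; last by exists (staircase_of c); rewrite toffoli_circuitE;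
  split=> //; apply: staircase_staircase_of.
  apply/permutation_gateP; exists m, (triangular_map c); split=> // x.
  by rewrite mE -E aK gK bK.
- have -> : basis_map_op C m = basis_map_op C b' *m (basis_map_op C f *m
  basis_map_op C a').
    by rewrite !basis_map_op_comp; apply: eq_basis_map_op.
  apply: clifford3_mull; first exact: affine_clifford2 (affine_bij_inv Hb).
    (* The adjoint of the gate of [b'] is the gate of its inverse [b]. *)
    rewrite basis_map_monomial (monomial_adjoint _ b'K bK).
    rewrite (eq_monomial (frefl b) (t := fun=> 1)); last by move=> v;
      rewrite conjC1.
    by rewrite -basis_map_monomial; apply: affine_clifford2 Hb.
  exact: clifford3_mulr H3 (affine_clifford2 (affine_bij_inv Ha)).
- by rewrite !basis_map_op_comp; apply: eq_basis_map_op => x; rewrite fE.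
Qed.
End Operators.

Theorem mainTheorem1 (R : realType) (n : nat) (pi : operator R[i] n) :
  permutation_gate pi -> clifford_hierarchy 3 pi ->
  exists phi1 phi2 mu : operator R[i] n,
    [/\ clifford_permutation phi1,
        clifford_permutation phi2,
        permutation_gate mu
        /\ (exists s : seq ('I_n * 'I_n * 'I_n),
              staircase R[i] s /\ mu = toffoli_circuit R[i] s),
        clifford_hierarchy 3 mu
      & pi = phi1 *m mu *m phi2].
Proof. exact: clifford3_staircase. Qed.
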